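(* Let $p,q\in(M,\tau)$ be Hermitian, freely independent, and have $2$ atoms in their spectra, i.e. $\mu_p=a\delta_\alpha+(1-a)\delta_{\alpha'}$ and $\mu_q=b\delta_\beta+(1-b)\delta_{\beta'}$ with $a,b\in(0,1)$, $\alpha,\alpha',\beta,\beta'\in\mathbb{R}$, $\alpha\ne\alpha'$, $\beta\ne\beta'$. Then $X=p+iq$ is not normal.
   Context: $(M,\tau)$ is a von Neumann algebra with a faithful, normal, tracial state $\tau$; free independence is with respect to $\tau$. For Hermitian $y\in M$, $\mu_y$ is the spectral measure of $y$ with respect to $\tau$. *)

(* Defs.v *)
From HB Require Import structures.
From mathcomp Require Export all_boot all_order all_algebra.
From mathcomp Require Export complex.
From mathcomp Require Export all_classical all_reals all_analysis.
Export numFieldNormedType.Exports.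
Export Order.TTheory GRing.Theory Num.Theory.

Set Implicit Arguments.
Unset Strict Implicit.
Unset Printing Implicit Defensive.

Global Open Scope complex_scope.
Global Open Scope classical_set_scope.
Global Open Scope ring_scope.

(* A complex Hilbert space is a complete normed space H over R[i] with an inner
   product, linear in the first variable, inducing the norm.  Operators are
   plain functions H -> H: sums and scalings are pointwise, the product is
   composition and the unit is idfun. *)
Definition hilbert_inner (R : realType) (H : completeNormedModType R[i])
    (ip : {dot H for (@Num.conj R[i])}) : Prop :=
  forall x : H, ip x x = `|x| ^+ 2.

Section Operators.
Variables (R : realType) (H : completeNormedModType R[i]).
Variable ip : {dot H for (@Num.conj R[i])}.

Definition bounded_op (T : H -> H) : Prop := linear T /\ continuous T.

(* S = T^*.  Kept as a relation so that the Riesz representation theorem is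
   not needed to name the adjoint; it determines S uniquely. *)
Definition adjoint (T S : H -> H) : Prop :=
  forall x y : H, ip (T x) y = ip x (S y).

Definition hermitian_op (T : H -> H) : Prop := adjoint T T.

Definition normal_op (T : H -> H) : Prop :=
  exists2 S : H -> H, adjoint T S & T \o S = S \o T.

(* In the partial order of R[i], 0 <= z says that z is real and nonnegative. *)
Definition positive_op (T : H -> H) : Prop := forall x : H, 0 <= ip (T x) x.

Definition op_le (T S : H -> H) : Prop := positive_op (S - T).

Record unital_star_subalgebra (A : set (H -> H)) : Prop := {
  star_bounded : forall T, A T -> bounded_op T;
  star_one : A idfun;
  star_add : forall T S, A T -> A S -> A (T + S);
  star_scale : forall (c : R[i]) T, A T -> A (c *: T);
  star_mul : forall T S, A T -> A S -> A (T \o S);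
  star_adjoint : forall T, A T -> exists2 S, A S & adjoint T S
}.

(* A neighbourhood of T in the weak operator topology constrains finitely many
   matrix coefficients ip (T x) y. *)
Definition weak_op_closed (A : set (H -> H)) : Prop :=
  forall T, bounded_op T ->
    (forall (s : seq (H * H)) (e : R), 0 < e ->
       exists2 S, A S &
         forall xy, xy \in s -> `|ip (T xy.1 - S xy.1) xy.2| < e%:C) ->
    A T.

Definition von_neumann_algebra (M : set (H -> H)) : Prop :=
  unital_star_subalgebra M /\ weak_op_closed M.

Definition directed_op (D : set (H -> H)) : Prop :=
  D !=set0 /\
  forall T S, D T -> D S -> exists2 U, D U & op_le T U /\ op_le S U.

Definition op_lub (M D : set (H -> H)) (T : H -> H) : Prop :=
  [/\ M T, forall S, D S -> op_le S T &
      forall U, M U -> hermitian_op U -> (forall S, D S -> op_le S U) ->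
        op_le T U].

(* Only the values of tau on M matter. *)
Record faithful_normal_tracial_state
    (M : set (H -> H)) (tau : (H -> H) -> R[i]) : Prop := {
  state_linear : forall (c : R[i]) T S, M T -> M S ->
    tau (c *: T + S) = c * tau T + tau S;
  state_positive : forall T, M T -> positive_op T -> 0 <= tau T;
  state_one : tau idfun = 1;
  state_tracial : forall T S, M T -> M S -> tau (T \o S) = tau (S \o T);
  state_faithful : forall T, M T -> positive_op T -> tau T = 0 -> T = 0;
  state_normal : forall (D : set (H -> H)) T,
    D `<=` M -> (forall S, D S -> positive_op S) -> directed_op D ->
    op_lub M D T -> supremums (tau @` D) (tau T)
}.

Definition star_generated (x : H -> H) : set (H -> H) :=
  [set T | forall A, unital_star_subalgebra A -> A x -> A T].

Definition free_subalgebras (tau : (H -> H) -> R[i]) (I : eqType)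
    (A : I -> set (H -> H)) : Prop :=
  forall w : seq (I * (H -> H)),
    w <> [::] ->
    sorted (fun i j => i != j) (map fst w) ->
    (forall (i : I) T, (i, T) \in w -> A i T /\ tau T = 0) ->
    tau (foldr (fun c T => c.2 \o T) idfun w) = 0.

Definition freely_independent (tau : (H -> H) -> R[i]) (x y : H -> H) : Prop :=
  free_subalgebras tau
    (fun b : bool => if b then star_generated x else star_generated y).

(* E is the projection-valued spectral measure of the Hermitian operator y,
   y = \int t dE(t), with values in M.  Only the values of E on Borel sets
   matter.  For y in M the spectral projections always lie in M. *)
Record spectral_resolution (M : set (H -> H)) (y : H -> H)
    (E : set (measurableTypeR R) -> (H -> H)) : Prop := {
  spectral_in : forall B, measurable B -> M (E B);
  spectral_hermitian : forall B, measurable B -> hermitian_op (E B);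
  spectral_cap : forall B C, measurable B -> measurable C ->
    E (B `&` C) = E B \o E C;
  spectral_total : E setT = idfun;
  spectral_integral : forall x : H,
    exists nu : {measure set (measurableTypeR R) -> \bar R},
      [/\ forall B, measurable B -> nu B \is a fin_num /\
            ip (E B x) x = (fine (nu B))%:C,
          nu.-integrable setT (fun t : measurableTypeR R => (t : R)%:E) &
          ip (y x) x = (\int[nu]_t (t : R))%:C]
}.

(* mu_y (B) = tau (1_B (y)) *)
Definition spectral_measure (M : set (H -> H)) (tau : (H -> H) -> R[i])
    (y : H -> H) (mu : probability (measurableTypeR R) R) : Prop :=
  exists2 E, spectral_resolution M y E &
    forall B, measurable B -> tau (E B) = (fine (mu B))%:C.

End Operators.

(* Main.v *)
Require Import Defs.

(** Taking the Hermitian and skew-Hermitian parts, X = p + iq is normal exactly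
when p and q commute, so the claim is that two freely independent Hermitian
operators cannot commute unless one of them is a scalar.

Let P = p - tau(p) and Q = q - tau(q).  Freeness applied to the alternating
centered word P Q P Q gives tau(P Q P Q) = 0.  If p and q commute, then so do P
and Q, and the same number equals tau(P^2 Q^2), which freeness factors as
tau(P^2) tau(Q^2) ([free_commuting_variance]).  So one of the two variances
vanishes, and since P^2 and Q^2 are positive, faithfulness of tau makes p or q
scalar ([free_commuting_scalar]).

The spectral measure of a scalar operator c is a point mass: a vector in the
range of the spectral projection of {t} is an eigenvector of eigenvalue t, hence
t = c ([scalar_spectral_atom]).  This is incompatible with two distinct points
of positive mass. *)

Section FreeOperators.
Set Implicit Arguments.
Unset Strict Implicit.

Variables (R : realType) (H : completeNormedModType R[i]).
Variable ip : {dot H for (@Num.conj R[i])}.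
Implicit Types (T S p q x y : H -> H) (c : R[i]) (A M : set (H -> H)).
Implicit Types tau : (H -> H) -> R[i].

(** * Linear operators and adjoints *)

Lemma linearD_op T : linear T -> {morph T : x y / x + y}.
Proof. by move=> lT x y; have := lT 1 x y; rewrite !scale1r. Qed.

Lemma linear0_op T : linear T -> T 0 = 0.
Proof.
move=> lT; have := linearD_op lT 0 0; rewrite addr0 => /eqP.
by rewrite -subr_eq0 opprD addrA subrr sub0r oppr_eq0 => /eqP.
Qed.

Lemma linearZ_op T c : linear T -> {morph T : x / c *: x}.
Proof. by move=> lT x; have := lT c x 0; rewrite (linear0_op lT) !addr0. Qed.

Lemma linearB_op T : linear T -> {morph T : x y / x - y}.
Proof.
by move=> lT x y; rewrite (linearD_op lT) -scaleN1r (linearZ_op _ lT) scaleN1r.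
Qed.

Lemma star_linear A T : unital_star_subalgebra ip A -> A T -> linear T.
Proof. by move=> sA /(star_bounded sA) []. Qed.

Lemma star_sub_scalar A T c :
  unital_star_subalgebra ip A -> A T -> A (T - c *: idfun).
Proof.
move=> sA AT; rewrite -scaleNr.
by apply: (star_add sA) => //; apply: (star_scale sA); exact: (star_one sA).
Qed.

(** If S y and S' y have the same inner product with every vector, then so does
their difference with itself. *)
Lemma adjoint_unique T S S' : adjoint ip T S -> adjoint ip T S' -> S = S'.
Proof.
move=> aS aS'; apply/funext => y; apply/eqP; rewrite -subr_eq0 -(dnorm_eq0 ip).
by rewrite linearBr /= -aS -aS' subrr.
Qed.

Lemma adjoint_cartesian p q :
  hermitian_op ip p -> hermitian_op ip q ->
  adjoint ip (p + 'i%C *: q) (p - 'i%C *: q).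
Proof.
move=> hp hq x y; rewrite !fctE linearDl linearBr /= linearZl_LR linearZr_LR /=.
rewrite hp hq (_ : Num.conj 'i%C = - 'i%C :> R[i]) ?mulNr ?opprK //.
by apply/eqP; rewrite eq_complex /= oppr0 !eqxx.
Qed.

(** With X = p + iq, X X^* - X^* X = -2i (pq - qp). *)
Lemma cartesian_normal_commute p q :
  linear p -> linear q -> hermitian_op ip p -> hermitian_op ip q ->
  normal_op ip (p + 'i%C *: q) -> p \o q = q \o p.
Proof.
move=> lp lq hp hq [S aS]; rewrite (adjoint_unique aS (adjoint_cartesian hp hq)).
move=> /(congr1 (@^~ _)) nX; apply/funext => x; have {nX} := nX x.
rewrite !fctE /= (linearB_op lp) (linearD_op lp) (linearB_op lq) (linearD_op lq).
rewrite !(linearZ_op _ lp) !(linearZ_op _ lq) !scalerBr !scalerDr.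
set u := p (q x); set v := q (p x).
set w := 'i%C *: ('i%C *: q (q x)).
(* p p x and w occur on both sides; what remains is i (v - u) = i (u - v). *)
rewrite opprD !addrA => /addIr; rewrite -!addrA => /addrI e.
have : 'i%C *: (u - v) *+ 2 == 0.
  by rewrite scalerBr mulr2n -{1}e addrACA addNr subrr addr0.
rewrite -scaler_nat scalerA scaler_eq0 subr_eq0 => /orP[|/eqP //].
rewrite mulf_eq0 pnatr_eq0 /= eq_complex /= oner_eq0 andbF //.
Qed.

Lemma square_positive T : hermitian_op ip T -> positive_op ip (T \o T).
Proof. by move=> hT x /=; rewrite hT dnorm_ge0. Qed.

Lemma hermitian_shift T c :
  c \is Num.real -> hermitian_op ip T -> hermitian_op ip (T - c *: idfun).
Proof.
move=> cR hT x y; rewrite !fctE linearBl linearBr /= linearZl_LR linearZr_LR /=.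
by rewrite hT; congr (_ - _ * _); rewrite conj_Creal.
Qed.

(** * The star-algebra generated by one operator *)

Lemma star_generated_sub A p :
  unital_star_subalgebra ip A -> A p -> star_generated ip p `<=` A.
Proof. by move=> sA Ap T; apply. Qed.

(** An intersection of star-subalgebras is one.  Closure under adjoints uses that
adjoints are unique: every algebra in the intersection supplies some adjoint of
T, and they all coincide.  The ambient M bounds the elements and shows that
adjoints exist. *)
Lemma star_generated_algebra M p :
  unital_star_subalgebra ip M -> M p ->
  unital_star_subalgebra ip (star_generated ip p).
Proof.
move=> sM Mp; have gM := star_generated_sub sM Mp; split.
- by move=> T /gM /(star_bounded sM).
- by move=> A sA _; exact: (star_one sA).
- by move=> T S gT gS A sA Ap; apply: (star_add sA); [exact: gT|exact: gS].
- by move=> c T gT A sA Ap; apply: (star_scale sA); exact: gT.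
- by move=> T S gT gS A sA Ap; apply: (star_mul sA); [exact: gT|exact: gS].
move=> T gT; have [S _ aS] := star_adjoint sM (gM _ gT).
exists S => // A sA Ap; have [S' AS' aS'] := star_adjoint sA (gT _ sA Ap).
by rewrite (adjoint_unique aS aS').
Qed.

(** * Variance and free independence *)

Section TracialState.
Variables (M : set (H -> H)) (tau : (H -> H) -> R[i]).
Hypothesis sM : unital_star_subalgebra ip M.
Hypothesis st : faithful_normal_tracial_state ip M tau.

Let MZ : forall c T, M T -> M (c *: T) := star_scale sM.
Let MD : forall T S, M T -> M S -> M (T + S) := star_add sM.
Let MM : forall T S, M T -> M S -> M (T \o S) := star_mul sM.
Let M1 : M idfun := star_one sM.

Lemma state_shift T c : M T -> tau (T - c *: idfun) = tau T - c.
Proof.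
move=> MT; rewrite -scaleNr addrC (state_linear st) // (state_one st).
by rewrite mulr1 addrC.
Qed.

Lemma state_zero : tau 0 = 0.
Proof.
by have := state_shift 1 M1; rewrite scale1r subrr (state_one st) subrr.
Qed.

(** Positivity of tau only speaks of positive operators; a Hermitian T is reached
through 2 T = (T + 1)^2 - (T^2 + 1), where both squares are positive. *)
Lemma state_hermitian_real T : M T -> hermitian_op ip T -> tau T \is Num.real.
Proof.
move=> MT hT; have lT := star_linear sM MT.
have sqR S : M S -> hermitian_op ip S -> tau (S \o S) \is Num.real.
  move=> MS hS; apply/ger0_real/(state_positive st)/square_positive => //.
  exact: MM.
(* T + 1 is written T - (-1) so that the lemmas on T - c apply to it. *)
have h1 : hermitian_op ip (T - (-1) *: idfun).
  by apply: hermitian_shift => //; rewrite rpredN.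
have e : (T - (-1) *: idfun) \o (T - (-1) *: idfun) =
    2 *: T + (T \o T - (-1) *: idfun).
  apply/funext => x; rewrite !fctE /= !scaleN1r !opprK (linearD_op lT).
  by rewrite scaler_nat mulr2n addrACA [RHS]addrACA [T (T x) + _]addrC addrA.
have MTT : M (T \o T) by exact: MM.
have := sqR _ (star_sub_scalar _ sM MT) h1.
rewrite e (state_linear st) ?(state_shift _ MTT) //; last exact: star_sub_scalar.
move=> r2; have r1 : tau (T \o T) - -1 \is Num.real.
  apply: realB; first exact: sqR.
  by rewrite realN real1.
by have := rpredB r2 r1; rewrite addrK realMr // -?topredE /= ?ler0n // pnatr_eq0.
Qed.

(** D = T - tau(T) is Hermitian because tau(T) is real, so D^2 is positive and
faithfulness gives D^2 = 0; then <D x, D x> = <x, D^2 x> = 0. *)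
Lemma zero_variance_scalar T : M T -> hermitian_op ip T ->
  tau ((T - tau T *: idfun) \o (T - tau T *: idfun)) = 0 ->
  T = tau T *: idfun.
Proof.
move=> MT hT; set D := T - _ => D0.
have hD : hermitian_op ip D := hermitian_shift (state_hermitian_real MT hT) hT.
have MD' : M D by exact: star_sub_scalar.
have DD : D \o D = 0.
  by apply: (state_faithful st) => //; [exact: MM|exact: square_positive].
apply/eqP; rewrite -subr_eq0 -/D; apply/eqP/funext => x; apply/eqP.
by rewrite -(dnorm_eq0 ip) hD -[D (D x)]/((D \o D) x) DD linear0r.
Qed.

(** Expand the centered word (S - tau S) (T - tau T), whose trace is 0. *)
Lemma free_state_mul p q S T : M p -> M q -> freely_independent ip tau p q ->
  star_generated ip p S -> star_generated ip q T ->
  tau (S \o T) = tau S * tau T.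
Proof.
move=> Mp Mq fpq gS gT.
have gpA := star_generated_algebra sM Mp.
have gqA := star_generated_algebra sM Mq.
have MS := star_generated_sub sM Mp gS.
have MT := star_generated_sub sM Mq gT.
have lS := star_linear sM MS.
have : tau ((S - tau S *: idfun) \o ((T - tau T *: idfun) \o idfun)) = 0.
  apply: (fpq [:: (true, S - tau S *: idfun);
                  (false, T - tau T *: idfun)]) => //.
  move=> i U; rewrite !inE => /orP[]/eqP[-> ->]; rewrite state_shift // subrr.
    by split=> //; exact: (star_sub_scalar _ gpA).
  by split=> //; exact: (star_sub_scalar _ gqA).
have -> : (S - tau S *: idfun) \o ((T - tau T *: idfun) \o idfun) =
    (- tau T) *: S + ((- tau S) *: (T - tau T *: idfun) + (S \o T)).
  apply/funext => x; rewrite !fctE /= (linearB_op lS) (linearZ_op _ lS).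
  by rewrite !scaleNr [RHS]addrA [RHS]addrC addrA.
have MST : M (S \o T) by exact: MM.
have MT0 : M (T - tau T *: idfun) by exact: star_sub_scalar.
rewrite (state_linear st) ?(state_linear st) ?state_shift //; last first.
  by apply: MD => //; exact: MZ.
rewrite subrr mulr0 add0r mulNr addrC => /eqP.
by rewrite subr_eq0 mulrC => /eqP ->; rewrite mulrC.
Qed.

(** The trace of P^2 Q^2 = P Q P Q is computed twice: it is tau(P^2) tau(Q^2) since
P^2 and Q^2 lie in free algebras, and 0 since P Q P Q is an alternating centered
word. *)
Lemma free_commuting_variance p q : M p -> M q ->
  freely_independent ip tau p q -> p \o q = q \o p ->
  let P := p - tau p *: idfun in let Q := q - tau q *: idfun in
  tau (P \o P) * tau (Q \o Q) = 0.
Proof.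
move=> Mp Mq fpq pq P Q.
have lp := star_linear sM Mp; have lq := star_linear sM Mq.
have gpA := star_generated_algebra sM Mp.
have gqA := star_generated_algebra sM Mq.
have gP : star_generated ip p P by exact: (star_sub_scalar _ gpA).
have gQ : star_generated ip q Q by exact: (star_sub_scalar _ gqA).
rewrite -(free_state_mul Mp Mq fpq);
  [|exact: (star_mul gpA)|exact: (star_mul gqA)].
have PQ : P \o Q = Q \o P.
  apply/funext => x; have := congr1 (@^~ x) pq; rewrite /P /Q !fctE /= => pqx.
  rewrite (linearB_op lp) (linearB_op lq).
  rewrite (linearZ_op _ lp) (linearZ_op _ lq) pqx.
  rewrite !scalerBr !scalerA [tau q * _]mulrC !opprB.
  by rewrite addrACA [in RHS]addrACA [- _ + - _]addrC.
have -> : (P \o P) \o (Q \o Q) = P \o (Q \o (P \o (Q \o idfun))).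
  by apply/funext => x /=; congr P; have /= := congr1 (@^~ (Q x)) PQ.
apply: (fpq [:: (true, P); (false, Q); (true, P); (false, Q)]) => //= i T.
rewrite !inE => /or4P[]/eqP[-> ->]; split=> //;
  by rewrite state_shift // subrr.
Qed.

Lemma free_commuting_scalar p q : M p -> M q ->
  hermitian_op ip p -> hermitian_op ip q ->
  freely_independent ip tau p q -> p \o q = q \o p ->
  p = tau p *: idfun \/ q = tau q *: idfun.
Proof.
move=> Mp Mq hp hq fpq pq.
have /eqP := free_commuting_variance Mp Mq fpq pq.
by rewrite mulf_eq0 => /orP[]/eqP v0; [left|right]; exact: zero_variance_scalar.
Qed.

(** * Spectral measures of scalar operators *)

(** Take y <> 0 in the range of E {t}.  As E B y depends only on whether t is in B,
the measure nu of y is concentrated at t, so that <c y, y> = t <y, y>. *)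
Lemma scalar_spectral_atom c E (t : R) :
  spectral_resolution ip M (c *: idfun) E -> E [set t] <> 0 -> c = t%:C.
Proof.
move=> sE Et0.
have mt : measurable [set t : measurableTypeR R] by exact: measurable_set1.
have [x Ex] : exists x : H, E [set t] x != 0.
  apply: contrapT => nx; apply: Et0; apply/funext => x; apply/eqP.
  by apply: contrapT => /negP Ex; apply: nx; exists x.
set y := E [set t] x in Ex.
have Ey B : measurable B -> E B y = E (B `&` [set t]) x.
  by move=> mB; rewrite (spectral_cap sE).
have [nu [nuE nui yint]] := spectral_integral sE y.
have nut : nu (~` [set t]) = 0%E.
  have mC : measurable (~` [set t] : set (measurableTypeR R)).
    exact: measurableC.
  have [nuf e1] := nuE _ mC; have [nu0f e0] := nuE _ measurable0.
  (* E (~{t} `&` {t}) = E set0, and the empty set has measure 0. *)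
  move: e1; rewrite Ey // setICl -[in LHS](set0I [set t]) -Ey // e0 measure0.
  by case=> /esym /eqP; rewrite fine_eq0 // => /eqP.
have yy : ip y y = (fine (nu setT))%:C.
  by rewrite -(nuE _ measurableT).2 (spectral_total sE).
have nuI : \int[nu]_s (s : R) = t * fine (nu setT).
  rewrite -Rintegral_cst // /Rintegral; congr fine; apply: ae_eq_integral => //.
  exists (~` [set t]); split=> //; first exact: measurableC.
  by move=> s /= ns st'; apply: ns => _; rewrite st'.
move: yint; rewrite nuI fctE /= linearZl_LR /= yy rmorphM /= => /mulIf; apply.
by rewrite -yy dnorm_eq0.
Qed.

Lemma spectral_mass_unique c (mu : probability (measurableTypeR R) R) (s t : R) :
  spectral_measure ip M tau (c *: idfun) mu ->
  mu [set s] <> 0%E -> mu [set t] <> 0%E -> s = t.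
Proof.
move=> [E sE tE].
have atom (r : R) : mu [set r] <> 0%E -> c = r%:C.
  move=> mur; apply: (scalar_spectral_atom sE) => Er0; apply: mur.
  have mr : measurable [set r : measurableTypeR R] by exact: measurable_set1.
  have := tE _ mr; rewrite Er0 state_zero => -[] /esym /eqP.
  by rewrite fine_eq0 ?fin_num_measure // => /eqP.
by move=> /atom cs /atom; rewrite cs => -[].
Qed.

End TracialState.

Lemma two_atoms_charged (a t t' : R) (mu : probability (measurableTypeR R) R) :
  0 < a < 1 -> t <> t' ->
  (forall B, measurable B ->
    mu B = (a%:E * \d_t B + (1 - a)%:E * \d_t' B)%E) ->
  mu [set t] <> 0%E /\ mu [set t'] <> 0%E.
Proof.
move=> /andP[a0 a1] tt' muE.
have ms (r : R) : measurable [set r : measurableTypeR R].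
  exact: measurable_set1.
have dt (r s : R) : \d_r [set s] = (r == s)%:R%:E :> \bar R.
  by rewrite diracE; case: eqP => [->|rs]; [rewrite mem_set|rewrite memNset].
have /eqP/negbTE ntt := tt'; rewrite !muE // !dt !eqxx [t' == t]eq_sym ntt.
rewrite !mule0 !mule1 adde0 add0e; split; apply/eqP; rewrite eqe gt_eqF //.
by rewrite subr_gt0.
Qed.

End FreeOperators.

Theorem corollary5p5 (R : realType) (H : completeNormedModType R[i])
    (ip : {dot H for (@Num.conj R[i])})
    (M : set (H -> H)) (tau : (H -> H) -> R[i])
    (p q : H -> H) (mu_p mu_q : probability (measurableTypeR R) R)
    (a b alpha alpha' beta beta' : R) :
  hilbert_inner ip ->
  von_neumann_algebra ip M ->
  faithful_normal_tracial_state ip M tau ->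
  M p -> M q -> hermitian_op ip p -> hermitian_op ip q ->
  freely_independent ip tau p q ->
  spectral_measure ip M tau p mu_p ->
  spectral_measure ip M tau q mu_q ->
  0 < a < 1 -> 0 < b < 1 -> alpha <> alpha' -> beta <> beta' ->
  (forall B, measurable B ->
    mu_p B = (a%:E * \d_alpha B + (1 - a)%:E * \d_alpha' B)%E) ->
  (forall B, measurable B ->
    mu_q B = (b%:E * \d_beta B + (1 - b)%:E * \d_beta' B)%E) ->
  ~ normal_op ip (p + 'i%C *: q).
Proof.
move=> _ [sM _] st Mp Mq hp hq fpq smp smq a01 b01 aa' bb' mup muq nX.
have pq : p \o q = q \o p.
  have lp := star_linear sM Mp; have lq := star_linear sM Mq.
  exact: cartesian_normal_commute lp lq hp hq nX.
have [m1 m2] := two_atoms_charged a01 aa' mup.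
have [m3 m4] := two_atoms_charged b01 bb' muq.
have [ps|qs] := free_commuting_scalar sM st Mp Mq hp hq fpq pq.
  by apply: aa'; rewrite ps in smp; exact: spectral_mass_unique smp m1 m2.
by apply: bb'; rewrite qs in smq; exact: spectral_mass_unique smq m3 m4.
Qed.
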